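(* Let $\gamma(\theta,\varphi)=\bigl(a(\theta)\sin\theta\cos\varphi,\ a(\theta)\sin\theta\sin\varphi,\ b(\theta)\cos\theta\bigr)$, $(\theta,\varphi)\in[0,\pi]\times[0,2\pi)$, be a smooth axisymmetric surface with $a(\theta)>0$, $b(\theta)>0$. Let $p>0$ with $2p$ an odd positive integer, let $\mathbf{x}=(x,y,z)\in\mathbb{R}^3$ be a target point not on the surface with $\rho=\sqrt{x^2+y^2}>0$, let $f(\theta,\varphi)$ be smooth and $2\pi$-periodic in $\varphi$, and consider the layer potential $$u(\mathbf{x})=\int_0^{\pi}\int_0^{2\pi}\frac{f(\theta,\varphi)}{\|\gamma(\theta,\varphi)-\mathbf{x}\|^{2p}}\,d\varphi\,d\theta .$$ Let $n_\varphi$ be an even positive integer. Then, using the Fourier expansion of $f(\theta,\cdot)$ truncated to $n_\varphi$ terms (i.e. replacing $f(\theta,\varphi)$ in $u(\mathbf{x})$ by $f_{n_\varphi}(\theta,\varphi)=\sum_{k=-n_\varphi/2}^{n_\varphi/2-1}\widehat f_k(\theta)e^{ik\varphi}$), the layer potential $u(\mathbf{x})$ is approximated by $$\int_0^{\pi}\int_0^{2\pi}\frac{f_{n_\varphi}(\theta,\varphi)}{\|\gamma(\theta,\varphi)-\mathbf{x}\|^{2p}}\,d\varphi\,d\theta=\int_0^\pi \frac{1}{\sqrt{a(\theta)}}\;\frac{1}{\bigl(\lambda(\theta)+\sqrt{\lambda(\theta)^2-\rho^2\sin^2\theta}\bigr)^{1/2}}\;\frac{1}{\bigl(R_\lambda^2(\theta)\bigr)^{p-1/2}}\;\mathcal{F}(\theta)\,d\theta,$$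 where $$\mathcal{F}(\theta)=2\sum_{k=-n_\varphi/2}^{n_\varphi/2-1}\widehat f_k(\theta)\,e^{ik\,\mathrm{Re}(\varphi_0(\theta))}\,\mu_k^p(\chi(\theta)),\qquad \chi(\theta)=e^{-\mathrm{Im}(\varphi_0(\theta))},$$ and $$R_\lambda^2(\theta)=\bigl(a(\theta)\sin\theta-\rho\bigr)^2+\bigl(b(\theta)\cos\theta-z\bigr)^2 .$$
   Context: The functions $a,b$ are smooth (analytic) and positive on $[0,\pi]$. Discrete Fourier coefficients: $\widehat f_k(\theta)=\frac1{n_\varphi}\sum_{j=1}^{n_\varphi}f(\theta,\varphi_j)e^{-ik\varphi_j}$, computed from the $n_\varphi$ samples at the equispaced nodes $\varphi_j=2\pi(j-1)/n_\varphi$. For $\theta\in(0,\pi)$, $$\lambda(\theta)=\frac{a(\theta)^2\sin^2\theta+\rho^2+(b(\theta)\cos\theta-z)^2}{2a(\theta)}\ \ (>\rho\sin\theta),$$ and $\varphi_0(\theta)=\alpha+i\beta(\theta)$ is the complex root (in $\varphi$) of the squared-distance function $\|\gamma(\theta,\varphi)-\mathbf{x}\|^2$ with positive imaginary part, given by $$\alpha=\mathrm{atan2}(y,x),\qquad \beta(\theta)=\ln\!\left(\frac{\lambda(\theta)+\sqrt{\lambda(\theta)^2-\rho^2\sin^2\theta}}{\rho\sin\theta}\right)>0 ,$$ where $\mathrm{atan2}(y,x)\in(-\pi,\pi]$ is the argument of $x+iy$. The functions $\mu_k^p(\chi)$, $0<\chi<1$, $k\in\mathbb{Z}$, are defined by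 $\mu_{-k}^p=\mu_k^p$ and, for $m\ge 0$, by the recurrences $$\mu_m^{p}=\frac{1+\chi^2}{\chi}\,\frac{2(m-1)}{2m-1}\,\mu_{m-1}^{p}-\frac{2m-3}{2m-1}\,\mu_{m-2}^{p}\quad(p=1/2,\ m\ge2),$$ $$\mu_m^{p}=\frac{1+\chi^2}{2\chi}\,\mu_{m-1}^{p}-\frac{(1-\chi)^2}{2\chi}\,\frac{p+m-2}{p-1}\,\mu_{m-1}^{p-1}\quad(p>1/2,\ m\ge1),$$ with initial values $$\mu_0^{1/2}=2K,\quad \mu_1^{1/2}=\tfrac{2}{\chi}(K-E),\quad \mu_0^{3/2}=\tfrac{2}{1+\chi}\Bigl(\tfrac{2}{1+\chi}E-(1-\chi)K\Bigr),$$ $$\mu_0^{5/2}=\tfrac{2}{3(1+\chi)^4}\bigl(8(1+\chi^2)E-(1-\chi)(1+\chi)(5+3\chi^2)K\bigr),$$ where $K=K(\chi^2)=\int_0^{\pi/2}(1-\chi^2\sin^2 t)^{-1/2}dt$ and $E=E(\chi^2)=\int_0^{\pi/2}(1-\chi^2\sin^2 t)^{1/2}dt$. For $p>5/2$ (for which no closed form is listed) the initial value is $\mu_0^p(\chi)=(1-\chi)^{2p-1}\int_0^\pi(1-2\chi\cos\psi+\chi^2)^{-p}\,d\psi$. *)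

(* Defs.v *)
From Stdlib Require Export Reals ZArith.
From Stdlib Require Import Lra Lia.
From Coquelicot Require Export Coquelicot.
Open Scope R_scope.

(** ** Smoothness *)

(* C^infinity on a closed interval: existence of a C^infinity extension to the
   whole line. *)
Definition smooth_on (lo hi : R) (g : R -> R) : Prop :=
  exists h : R -> R,
    (forall (n : nat) (t : R), ex_derive_n h n t) /\
    (forall t : R, lo <= t <= hi -> h t = g t).

(* C^infinity on the strip [lo, hi] x R, in the same sense. *)
Definition smooth_strip (lo hi : R) (g : R -> R -> R) : Prop :=
  exists h : R -> R -> R,
    (forall (n : nat) (s t : R), ex_diff_n h n s t) /\
    (forall s t : R, lo <= s <= hi -> h s t = g s t).

Definition Csmooth_strip (lo hi : R) (g : R -> R -> C) : Prop :=
  smooth_strip lo hi (fun s t => Re (g s t)) /\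
  smooth_strip lo hi (fun s t => Im (g s t)).

(** ** Complex sums, integrals and exponentials *)

(* Integral of a complex-valued function of a real variable. *)
Definition CInt (g : R -> C) (lo hi : R) : C :=
  RInt (V := C_R_CompleteNormedModule) g lo hi.

Definition ex_CInt (g : R -> C) (lo hi : R) : Prop :=
  ex_RInt (V := C_R_NormedModule) g lo hi.

(* Sum of F k over the integers lo <= k <= hi; it is 0 when hi < lo. *)
Definition sumZ (lo hi : Z) (F : Z -> C) : C :=
  sum_n_m (G := C_AbelianMonoid) (fun i : nat => F (lo - 1 + Z.of_nat i)%Z)
    1 (Z.to_nat (hi - lo + 1)).

(* e^{it} for real t. *)
Definition cis (t : R) : C := (cos t, sin t).

(** ** Geometry *)

Definition gamma (a b : R -> R) (theta phi : R) : R * R * R :=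
  (a theta * sin theta * cos phi,
   a theta * sin theta * sin phi,
   b theta * cos theta).

Definition dist3 (P Q : R * R * R) : R :=
  let '(p1, p2, p3) := P in
  let '(q1, q2, q3) := Q in
  sqrt ((p1 - q1) ^ 2 + (p2 - q2) ^ 2 + (p3 - q3) ^ 2).

(** ** The truncated Fourier expansion *)

Definition node (n j : nat) : R := 2 * PI * (INR j - 1) / INR n.

Definition fhat (n : nat) (f : R -> R -> C) (k : Z) (theta : R) : C :=
  Cmult (RtoC (/ INR n))
    (sum_n_m (G := C_AbelianMonoid)
       (fun j => Cmult (f theta (node n j)) (cis (- (IZR k * node n j)))) 1 n).

Definition f_trunc (n : nat) (f : R -> R -> C) (theta phi : R) : C :=
  sumZ (- (Z.of_nat n / 2)) (Z.of_nat n / 2 - 1)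
    (fun k => Cmult (fhat n f k theta) (cis (IZR k * phi))).

(** ** The layer potential *)

Definition kernel_integrand (a b : R -> R) (p : R) (X : R * R * R)
    (f : R -> R -> C) (theta phi : R) : C :=
  Cdiv (f theta phi) (RtoC (Rpower (dist3 (gamma a b theta phi) X) (2 * p))).

Definition inner_potential (a b : R -> R) (p : R) (X : R * R * R)
    (f : R -> R -> C) (theta : R) : C :=
  CInt (kernel_integrand a b p X f theta) 0 (2 * PI).

Definition layer_potential (a b : R -> R) (p : R) (X : R * R * R)
    (f : R -> R -> C) : C :=
  CInt (inner_potential a b p X f) 0 PI.

(* [CInt] is total; this says that the iterated integral above is meaningful. *)
Definition ex_layer_potential (a b : R -> R) (p : R) (X : R * R * R)
    (f : R -> R -> C) : Prop :=
  (forall theta : R, 0 <= theta <= PI ->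
     ex_CInt (kernel_integrand a b p X f theta) 0 (2 * PI)) /\
  ex_CInt (inner_potential a b p X f) 0 PI.

(** ** The root of the squared distance *)

Definition rho (x y : R) : R := sqrt (x ^ 2 + y ^ 2).

(* The argument of x + iy in (-PI, PI], for (x, y) <> (0, 0);
   see [atan2_spec]. *)
Definition atan2 (y x : R) : R :=
  if Rle_dec 0 y then acos (x / rho x y) else - acos (x / rho x y).

Lemma atan2_spec (x y : R) : 0 < rho x y ->
  x = rho x y * cos (atan2 y x) /\ y = rho x y * sin (atan2 y x) /\
  - PI < atan2 y x <= PI.
Proof.
intros Hr.
assert (Hsq : rho x y * rho x y = x ^ 2 + y ^ 2) by (apply sqrt_sqrt; nra).
assert (Hb : -1 <= x / rho x y <= 1).
{ split.
  - apply Rmult_le_reg_r with (rho x y); [lra|].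
    unfold Rdiv; rewrite Rmult_assoc, Rinv_l by lra; nra.
  - apply Rmult_le_reg_r with (rho x y); [lra|].
    unfold Rdiv; rewrite Rmult_assoc, Rinv_l by lra; nra. }
assert (Hc : cos (acos (x / rho x y)) = x / rho x y) by (apply cos_acos; lra).
assert (Hs : rho x y * sin (acos (x / rho x y)) = Rabs y).
{ rewrite sin_acos by lra.
  replace (1 - (x / rho x y)²) with ((y / rho x y)²)
    by (unfold Rsqr; replace (y / rho x y * (y / rho x y))
          with ((y ^ 2) / (rho x y * rho x y)) by (field; lra);
        replace (y ^ 2) with (rho x y * rho x y - x ^ 2) by lra; field; lra).
  rewrite sqrt_Rsqr_abs. unfold Rdiv.
  rewrite Rabs_mult, (Rabs_pos_eq (/ rho x y))
    by (apply Rlt_le, Rinv_0_lt_compat, Hr).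
  field; lra. }
pose proof (acos_bound (x / rho x y)) as HB.
pose proof PI_RGT_0 as HPI.
unfold atan2; destruct (Rle_dec 0 y) as [Hy|Hy].
- rewrite Hc; rewrite Hs, Rabs_pos_eq by lra.
  repeat split; try lra; field; lra.
- rewrite cos_neg, sin_neg, Hc.
  rewrite Ropp_mult_distr_r_reverse, Hs, Rabs_left by lra.
  repeat split; try lra; [field; lra|].
  destruct (Req_dec (acos (x / rho x y)) PI) as [e|e]; [|lra].
  exfalso; rewrite e, sin_PI, Rabs_left in Hs by lra; lra.
Qed.

Definition lambda (a b : R -> R) (x y z theta : R) : R :=
  (a theta ^ 2 * sin theta ^ 2 + rho x y ^ 2 + (b theta * cos theta - z) ^ 2)
  / (2 * a theta).

(* lambda + sqrt (lambda^2 - rho^2 sin^2 theta) *)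
Definition Lambda (a b : R -> R) (x y z theta : R) : R :=
  lambda a b x y z theta
  + sqrt (lambda a b x y z theta ^ 2 - rho x y ^ 2 * sin theta ^ 2).

Definition beta (a b : R -> R) (x y z theta : R) : R :=
  ln (Lambda a b x y z theta / (rho x y * sin theta)).

Definition phi0 (a b : R -> R) (x y z theta : R) : C :=
  (atan2 y x, beta a b x y z theta).

Definition chi (a b : R -> R) (x y z theta : R) : R :=
  exp (- Im (phi0 a b x y z theta)).

(** ** The functions mu_k^p *)

(* Complete elliptic integrals as functions of the parameter (squared
   modulus). *)
Definition ellK (m : R) : R := RInt (fun t => / sqrt (1 - m * sin t ^ 2)) 0 (PI / 2).
Definition ellE (m : R) : R := RInt (fun t => sqrt (1 - m * sin t ^ 2)) 0 (PI / 2).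

(* The half-integer exponents p are indexed by q = p - 1/2. *)
Definition half_odd (q : nat) : R := INR q + 1 / 2.

(* mu_0^p, p = half_odd q *)
Definition mu_init (q : nat) (c : R) : R :=
  match q with
  | 0%nat => 2 * ellK (c ^ 2)
  | 1%nat =>
      2 / (1 + c) * (2 / (1 + c) * ellE (c ^ 2) - (1 - c) * ellK (c ^ 2))
  | 2%nat =>
      2 / (3 * (1 + c) ^ 4)
      * (8 * (1 + c ^ 2) * ellE (c ^ 2)
         - (1 - c) * (1 + c) * (5 + 3 * c ^ 2) * ellK (c ^ 2))
  | _ =>
      Rpower (1 - c) (2 * half_odd q - 1)
      * RInt (fun psi => Rpower (1 - 2 * c * cos psi + c ^ 2) (- half_odd q)) 0 PI
  end.

(* mu_m^{1/2} *)
Fixpoint mu_half (c : R) (m : nat) {struct m} : R :=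
  match m with
  | 0%nat => mu_init 0 c
  | S m1 =>
      match m1 with
      | 0%nat => 2 / c * (ellK (c ^ 2) - ellE (c ^ 2))
      | S m2 =>
          (1 + c ^ 2) / c * (2 * (INR m - 1) / (2 * INR m - 1)) * mu_half c m1
          - (2 * INR m - 3) / (2 * INR m - 1) * mu_half c m2
      end
  end.

(* mu_m^p for m >= 0, p = half_odd q *)
Fixpoint mu_nat (q : nat) (c : R) {struct q} : nat -> R :=
  match q with
  | 0%nat => mu_half c
  | S q1 =>
      fix mu_q (m : nat) : R :=
        match m with
        | 0%nat => mu_init q c
        | S m1 =>
            (1 + c ^ 2) / (2 * c) * mu_q m1
            - (1 - c) ^ 2 / (2 * c)
              * ((half_odd q + INR m - 2) / (half_odd q - 1)) * mu_nat q1 c m1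
        end
  end.

(* mu_k^p for k in Z, p = half_odd q *)
Definition mu (q : nat) (k : Z) (c : R) : R := mu_nat q c (Z.abs_nat k).

(** ** The reduced one-dimensional integrand *)

Definition R_lambda2 (a b : R -> R) (x y z theta : R) : R :=
  (a theta * sin theta - rho x y) ^ 2 + (b theta * cos theta - z) ^ 2.

Definition calF (a b : R -> R) (q : nat) (x y z : R) (n : nat)
    (f : R -> R -> C) (theta : R) : C :=
  Cmult (RtoC 2)
    (sumZ (- (Z.of_nat n / 2)) (Z.of_nat n / 2 - 1)
       (fun k =>
          Cmult (Cmult (fhat n f k theta)
                       (cis (IZR k * Re (phi0 a b x y z theta))))
                (RtoC (mu q k (chi a b x y z theta))))).

(* For q = p - 1/2; the value at theta = 0 and theta = PI, where
   rho * sin theta = 0, is irrelevant to the integral. *)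
Definition reduced_integrand (a b : R -> R) (q : nat) (x y z : R) (n : nat)
    (f : R -> R -> C) (theta : R) : C :=
  Cmult
    (RtoC (1 / sqrt (a theta)
           * (1 / Rpower (Lambda a b x y z theta) (1 / 2))
           * (1 / Rpower (R_lambda2 a b x y z theta) (half_odd q - 1 / 2))))
    (calF a b q x y z n f theta).

(* Main.v *)
Require Import Defs.
From Stdlib Require Import Reals ZArith.
From Coquelicot Require Import Coquelicot.
From Stdlib Require Import Lra Lia.
Open Scope R_scope.

(* With c = chi, the squared distance factors as
   a Lambda (1 - 2 c cos (phi - alpha) + c^2), so by periodicity and parity the
   integral of e^{ik phi} dist^{-2p} over a circle of latitude is
   2 (a Lambda)^{-p} e^{ik alpha} times
     I_k^p = int_0^PI cos (k t) (1 - 2 c cos t + c^2)^{-p} dt.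
   Since R_lambda^2 = a Lambda (1 - c)^2, everything reduces to
   mu_k^p = (1 - c)^{2p-1} I_k^p.  The recurrences for mu are an expansion of
   the kernel and an integration by parts; the initial values for p = 1/2 come
   from Landen's substitution, those for p = 3/2, 5/2 from the recurrences. *)

(** * The kernel integrals and their recurrences *)

(** The obstacle is the outer variable. At the poles [rho sin theta = 0], so the formula behind
    [chi] divides by zero and the reduction to [mu] holds only for [0 < theta < PI], while
    integrability is claimed up to the endpoints. Continuity is therefore proved for the
    trigonometric moments of [dist^{-2p}], which make sense on the closed interval because the
    target is off the surface; the reduced integrand inherits integrability by agreeing with them in
    the interior. The factorization of the squared distance rests on one quadratic: [Lambda] is the
    larger root of [X^2 - 2 lambda X + rho^2 sin^2 theta], and [chi = rho sin theta / Lambda].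
    Equivalently, the squared distance is [a Lambda |1 - chi e^{i(phi - alpha)}|^2], and
    [e^{i phi0} = chi e^{i alpha}] is its zero inside the unit circle. *)

Definition ker (c t : R) : R := 1 - 2 * c * cos t + c ^ 2.

(** The order [m] is real, so the shifts [m - 1] and [m + 1] never leave the domain; integrality
    enters only as [sin (m * PI) = 0]. *)
Definition kint (p m c : R) : R :=
  RInt (fun t => cos (m * t) * Rpower (ker c t) (- p)) 0 PI.

Lemma ker_pos (c t : R) : 0 < c < 1 -> 0 < ker c t.
Proof.
intros Hc; unfold ker; pose proof (COS_bound t); nra.
Qed.

Lemma ex_derive_ker_Rpower (c p t : R) : 0 < c < 1 ->
  ex_derive (fun t => Rpower (ker c t) p) t.
Proof.
intros Hc; pose proof (ker_pos c t Hc).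
unfold Rpower, ker in *; auto_derive; lra.
Qed.

Lemma continuous_kint (p m c t : R) : 0 < c < 1 ->
  continuous (fun t => cos (m * t) * Rpower (ker c t) p) t.
Proof.
intros Hc; apply (ex_derive_continuous (V := R_NormedModule)).
apply (ex_derive_mult (fun t => cos (m * t))).
- auto_derive; trivial.
- now apply ex_derive_ker_Rpower.
Qed.

Lemma is_RInt_kint (p m c : R) : 0 < c < 1 ->
  is_RInt (fun t => cos (m * t) * Rpower (ker c t) (- p)) 0 PI (kint p m c).
Proof.
intros Hc; apply (RInt_correct (V := R_CompleteNormedModule)).
apply (ex_RInt_continuous (V := R_CompleteNormedModule)).
intros; now apply continuous_kint.
Qed.

Lemma kint_opp (p m c : R) : kint p (- m) c = kint p m c.
Proof.
apply RInt_ext; intros t _.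
replace (- m * t) with (- (m * t)) by ring; now rewrite cos_neg.
Qed.

Lemma Rpower_ker_step (c p t : R) : 0 < c < 1 ->
  Rpower (ker c t) (- p) = ker c t * Rpower (ker c t) (- (p + 1)).
Proof.
intros Hc; pose proof (ker_pos c t Hc).
rewrite <- (Rpower_1 (ker c t)) at 2 by trivial.
rewrite <- Rpower_plus; f_equal; ring.
Qed.

(** One factor [ker] is split off and multiplied out, with [2 cos t cos (m t) = cos ((m + 1) t) +
    cos ((m - 1) t)]. *)
Lemma kint_expand (p m c : R) : 0 < c < 1 ->
  kint p m c = (1 + c ^ 2) * kint (p + 1) m c
               - c * (kint (p + 1) (m + 1) c + kint (p + 1) (m - 1) c).
Proof.
intros Hc; apply (is_RInt_unique (V := R_CompleteNormedModule)).
eapply is_RInt_ext; [|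
  apply (is_RInt_minus (V := R_NormedModule));
  [ apply (is_RInt_scal (V := R_NormedModule)), is_RInt_kint, Hc
  | apply (is_RInt_scal (V := R_NormedModule)),
      (is_RInt_plus (V := R_NormedModule)); apply is_RInt_kint, Hc ] ].
intros t _; simpl; rewrite (Rpower_ker_step c p) by trivial.
generalize (Rpower (ker c t) (- (p + 1))); intros r; unfold ker.
replace ((m + 1) * t) with (m * t + t) by ring.
replace ((m - 1) * t) with (m * t - t) by ring.
rewrite cos_plus, cos_minus.
unfold minus, plus, opp, scal, mult; simpl; unfold mult; simpl; ring.
Qed.

(* Integration by parts of the derivative of [sin (m t) ker^-p]. *)
Lemma kint_by_parts (p m c : R) : 0 < c < 1 -> sin (m * PI) = 0 ->
  m * kint p m c
  = p * c * (kint (p + 1) (m - 1) c - kint (p + 1) (m + 1) c).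
Proof.
intros Hc Hm.
assert (H : is_RInt (fun t =>
   m * (cos (m * t) * Rpower (ker c t) (- p))
   - p * c * (cos ((m - 1) * t) * Rpower (ker c t) (- (p + 1))
              - cos ((m + 1) * t) * Rpower (ker c t) (- (p + 1)))) 0 PI
   (sin (m * PI) * Rpower (ker c PI) (- p)
    - sin (m * 0) * Rpower (ker c 0) (- p))).
{ apply (is_RInt_derive (V := R_CompleteNormedModule)
           (fun t => sin (m * t) * Rpower (ker c t) (- p))).
  - intros t _; pose proof (ker_pos c t Hc) as Hk.
    replace ((m + 1) * t) with (m * t + t) by ring.
    replace ((m - 1) * t) with (m * t - t) by ring.
    rewrite cos_plus, cos_minus.
    rewrite (Rpower_ker_step c p) by trivial.
    replace (- (p + 1)) with (- p + - (1)) by ring.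
    rewrite Rpower_plus.
    replace (Rpower (ker c t) (- (1))) with (/ ker c t)
      by (rewrite Rpower_Ropp, Rpower_1; trivial).
    unfold Rpower, ker in *; auto_derive; [lra|].
    replace (1 + - (2 * c * cos t) + c * (c * 1))
      with (1 - 2 * c * cos t + c ^ 2) by ring.
    field; lra.
  - intros t _.
    apply (continuous_minus (V := R_NormedModule)).
    + apply (continuous_scal_r (V := R_NormedModule)), continuous_kint, Hc.
    + apply (continuous_scal_r (V := R_NormedModule)).
      apply (continuous_minus (V := R_NormedModule)); apply continuous_kint, Hc. }
rewrite Hm, Rmult_0_r, sin_0 in H.
apply (is_RInt_unique (V := R_CompleteNormedModule)) in H.
erewrite (is_RInt_unique (V := R_CompleteNormedModule)) in H; [|
  apply (is_RInt_minus (V := R_NormedModule));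
  [ apply (is_RInt_scal (V := R_NormedModule)), is_RInt_kint, Hc
  | apply (is_RInt_scal (V := R_NormedModule)),
      (is_RInt_minus (V := R_NormedModule)); apply is_RInt_kint, Hc ] ].
unfold minus, plus, opp, scal, mult in H; simpl in H; unfold mult in H;
  simpl in H; lra.
Qed.

(** Expansion and integration by parts are two linear relations between the levels [p] and [p + 1];
    eliminating order [m - 1] at the upper level gives the recurrence. *)
Lemma kint_rec (p m c : R) : 0 < c < 1 -> p <> 0 -> sin (m * PI) = 0 ->
  kint (p + 1) (m + 1) c
  = (1 + c ^ 2) / (2 * c) * kint (p + 1) m c
    - (p + m) / (2 * c * p) * kint p m c.
Proof.
intros Hc Hp Hm.
pose proof (kint_expand p m c Hc) as H1.
pose proof (kint_by_parts p m c Hc Hm) as H2.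
assert (H3 : kint (p + 1) (m - 1) c
             = m / (p * c) * kint p m c + kint (p + 1) (m + 1) c).
{ replace (m / (p * c) * kint p m c) with (m * kint p m c / (p * c))
    by (field; lra).
  rewrite H2; field; lra. }
rewrite H3 in H1.
assert (H4 : 2 * c * kint (p + 1) (m + 1) c
             = (1 + c ^ 2) * kint (p + 1) m c - (p + m) / p * kint p m c).
{ replace ((p + m) / p * kint p m c) with (kint p m c + m / p * kint p m c)
    by (field; exact Hp).
  rewrite H1 at 1; field; lra. }
replace (kint (p + 1) (m + 1) c)
  with (2 * c * kint (p + 1) (m + 1) c / (2 * c)) by (field; lra).
rewrite H4; field; lra.
Qed.

(** Both relations are taken at [p = -1/2]; eliminating that level leaves a three-term relation
    closed at level [1/2], the bottom of the ladder in [p]. *)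
Lemma kint_half_rec (m c : R) : 0 < c < 1 -> sin (m * PI) = 0 ->
  (2 * m + 1) * c * kint (1 / 2) (m + 1) c
  = 2 * m * (1 + c ^ 2) * kint (1 / 2) m c
    - (2 * m - 1) * c * kint (1 / 2) (m - 1) c.
Proof.
intros Hc Hm.
pose proof (kint_expand (- (1 / 2)) m c Hc) as H1.
pose proof (kint_by_parts (- (1 / 2)) m c Hc Hm) as H2.
replace (- (1 / 2) + 1) with (1 / 2) in * by lra.
rewrite H1 in H2; lra.
Qed.

(* Eliminate [kint (p + 1) 1] and [kint (p + 1) 2] from the recurrences. *)
Lemma kint_0_rec (p c : R) : 0 < c < 1 -> p <> 0 ->
  (1 - c ^ 2) ^ 2 * kint (p + 1) 0 c
  = (1 + c ^ 2) * kint p 0 c + 2 * c * (p - 1) / p * kint p 1 c.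
Proof.
intros Hc Hp.
assert (Hs : sin (1 * PI) = 0) by (rewrite Rmult_1_l; apply sin_PI).
assert (Hs0 : sin (0 * PI) = 0) by (rewrite Rmult_0_l; apply sin_0).
pose proof (kint_rec p 0 c Hc Hp Hs0) as H1.
pose proof (kint_by_parts p 1 c Hc Hs) as H2.
pose proof (kint_expand p 1 c Hc) as H3.
rewrite Rplus_0_l in H1.
replace (1 - 1) with 0 in * by ring.
assert (H4 : kint (p + 1) (1 + 1) c
             = kint (p + 1) 0 c - 1 * kint p 1 c / (p * c)).
{ rewrite H2; field; lra. }
rewrite H1, H4 in H3.
(* The coefficient of the unknown becomes [(1 + c^2)^2 - 4 c^2 = (1 - c^2)^2]. *)
apply (Rmult_eq_compat_l (2 * c)) in H3.
match type of H3 with _ = ?r =>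
  assert (H5 : r = (1 - c ^ 2) ^ 2 * kint (p + 1) 0 c
                   - (1 + c ^ 2) * kint p 0 c + 2 * c * kint p 1 c / p)
    by (field; lra) end.
rewrite H5 in H3.
replace (2 * c * (p - 1) / p * kint p 1 c)
  with (2 * c * kint p 1 c - 2 * c * kint p 1 c / p) by (field; exact Hp).
lra.
Qed.

(** * Landen's substitution *)

Lemma elliptic_pos (c t : R) : 0 < c < 1 -> 0 < 1 - c ^ 2 * sin t ^ 2.
Proof.
intros Hc; pose proof (SIN_bound t).
assert (0 <= sin t ^ 2 <= 1) by nra. assert (0 < c ^ 2 < 1) by nra. nra.
Qed.

Lemma ex_derive_elliptic (c t : R) : 0 < c < 1 ->
  ex_derive (fun t => sqrt (1 - c ^ 2 * sin t ^ 2)) t.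
Proof.
intros Hc; pose proof (elliptic_pos c t Hc); auto_derive; lra.
Qed.

(** [ellK] and [ellE] live on [[0, PI / 2]], whereas Landen's substitution runs over [[0, PI]]; the
    reflection [t -> PI - t] carries one half onto the other. *)
Lemma RInt_reflect_PI (g : R -> R) :
  (forall t, continuous g t) -> (forall t, g (PI - t) = g t) ->
  is_RInt g 0 PI (2 * RInt g 0 (PI / 2)).
Proof.
intros Hg Hs.
assert (H1 : forall u v, is_RInt g u v (RInt g u v)).
{ intros u v; apply (RInt_correct (V := R_CompleteNormedModule)).
  apply (ex_RInt_continuous (V := R_CompleteNormedModule)); intros; apply Hg. }
replace (2 * RInt g 0 (PI / 2))
  with (plus (RInt g 0 (PI / 2)) (RInt g 0 (PI / 2)))
  by (unfold plus; simpl; ring).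
apply (is_RInt_Chasles (V := R_NormedModule)) with (PI / 2); [apply H1|].
apply (is_RInt_ext (V := R_NormedModule)) with
  (fun t => opp (scal (-1) (g (-1 * t + PI)))).
{ intros t _; replace (-1 * t + PI) with (PI - t) by ring.
  rewrite Hs; unfold opp, scal; simpl; unfold mult; simpl; ring. }
replace (RInt g 0 (PI / 2)) with (opp (opp (RInt g 0 (PI / 2))))
  by (unfold opp; simpl; ring).
apply (is_RInt_opp (V := R_NormedModule)).
apply (is_RInt_comp_lin (V := R_NormedModule)).
apply (is_RInt_swap (V := R_NormedModule)).
replace (-1 * (PI / 2) + PI) with (PI / 2) by field.
replace (-1 * PI + PI) with 0 by ring.
apply H1.
Qed.

Lemma is_RInt_ellK (c : R) : 0 < c < 1 ->
  is_RInt (fun t => / sqrt (1 - c ^ 2 * sin t ^ 2)) 0 PI (2 * ellK (c ^ 2)).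
Proof.
intros Hc; apply RInt_reflect_PI.
- intros t; apply (ex_derive_continuous (V := R_NormedModule)), ex_derive_inv.
  + now apply ex_derive_elliptic.
  + apply Rgt_not_eq, sqrt_lt_R0, elliptic_pos, Hc.
- intros t; now rewrite sin_PI_x.
Qed.

Lemma is_RInt_ellE (c : R) : 0 < c < 1 ->
  is_RInt (fun t => sqrt (1 - c ^ 2 * sin t ^ 2)) 0 PI (2 * ellE (c ^ 2)).
Proof.
intros Hc; apply RInt_reflect_PI.
- intros t; apply (ex_derive_continuous (V := R_NormedModule)).
  now apply ex_derive_elliptic.
- intros t; now rewrite sin_PI_x.
Qed.

(* In the triangle with vertices 0, [c] and [e^{it}], the angle at 0 is [t] and
   the exterior angle at [c] is [s]; the law of sines gives the substitution
   [t = landen c s], the law of cosines the length of the side opposite to 0. *)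
Definition landen (c s : R) : R := s - asin (c * sin s).

Lemma landen_arg (c s : R) : 0 < c < 1 -> -1 < c * sin s < 1.
Proof. intros Hc; pose proof (SIN_bound s); nra. Qed.

Lemma cos_landen (c s : R) : 0 < c < 1 ->
  cos (landen c s)
  = cos s * sqrt (1 - c ^ 2 * sin s ^ 2) + c * sin s ^ 2.
Proof.
intros Hc; pose proof (landen_arg c s Hc).
unfold landen; rewrite cos_minus, cos_asin, sin_asin by lra.
replace (1 - (c * sin s)²) with (1 - c ^ 2 * sin s ^ 2) by (unfold Rsqr; ring).
ring.
Qed.

(** This is the length of the side from [c] to [e^{it}], positive because [c] lies inside the unit
    circle: for [cos s > 0], the inequality [c^2 cos^2 s < 1 - c^2 sin^2 s] amounts to [c^2 < 1]. *)
Lemma landen_side_pos (c s : R) : 0 < c < 1 ->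
  0 < sqrt (1 - c ^ 2 * sin s ^ 2) - c * cos s.
Proof.
intros Hc; pose proof (sin2_cos2 s) as H; unfold Rsqr in H.
pose proof (COS_bound s).
destruct (Rle_lt_dec (cos s) 0).
- pose proof (sqrt_lt_R0 _ (elliptic_pos c s Hc)); nra.
- assert (c * cos s < sqrt (1 - c ^ 2 * sin s ^ 2)); [|lra].
  rewrite <- (sqrt_pow2 (c * cos s)) by nra.
  apply sqrt_lt_1; [nra|apply Rlt_le, elliptic_pos, Hc|nra].
Qed.

Lemma Rpower_ker_landen (c s : R) : 0 < c < 1 ->
  Rpower (ker c (landen c s)) (- (1 / 2))
  = / (sqrt (1 - c ^ 2 * sin s ^ 2) - c * cos s).
Proof.
intros Hc.
rewrite Rpower_Ropp; f_equal.
replace (1 / 2) with (/ 2) by lra.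
rewrite Rpower_sqrt by now apply ker_pos.
rewrite <- (sqrt_pow2 (sqrt (1 - c ^ 2 * sin s ^ 2) - c * cos s))
  by apply Rlt_le, landen_side_pos, Hc.
f_equal; unfold ker; rewrite cos_landen by trivial.
pose proof (sin2_cos2 s) as H; unfold Rsqr in H.
pose proof (sqrt_sqrt _ (Rlt_le _ _ (elliptic_pos c s Hc))) as H1.
set (d := sqrt _) in *.
replace ((d - c * cos s) ^ 2)
  with (d * d - 2 * c * d * cos s + c ^ 2 * (cos s * cos s)) by ring.
rewrite H1; replace (cos s * cos s) with (1 - sin s * sin s) by lra; ring.
Qed.

Lemma is_derive_landen (c s : R) : 0 < c < 1 ->
  is_derive (landen c) s (1 - c * cos s / sqrt (1 - c ^ 2 * sin s ^ 2)).
Proof.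
intros Hc.
apply (is_derive_minus (V := R_NormedModule) (fun s => s)
         (fun s => asin (c * sin s))).
- apply (is_derive_id (K := R_AbsRing)).
- replace (c * cos s / sqrt (1 - c ^ 2 * sin s ^ 2))
    with (scal (c * cos s) (/ sqrt (1 - (c * sin s)²))).
  + apply (is_derive_comp asin (fun s => c * sin s)).
    * apply is_derive_Reals.
      replace (/ sqrt (1 - (c * sin s)²)) with (1 / sqrt (1 - (c * sin s)²))
        by (unfold Rdiv; ring).
      exact (derive_pt_eq_1 _ _ _ _ (derive_pt_asin _ (landen_arg c s Hc))).
    * auto_derive; trivial; ring.
  + replace (1 - (c * sin s)²) with (1 - c ^ 2 * sin s ^ 2)
      by (unfold Rsqr; ring).
    reflexivity.
Qed.

(** With [d = sqrt (1 - c^2 sin^2 s)], the Jacobian [(d - c cos s) / d] cancels against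
    [ker^{-1/2} = 1 / (d - c cos s)], leaving the integrand [1 / d] of [ellK]; the endpoints 0 and
    [PI] are fixed. *)
Lemma is_RInt_landen (m c : R) : 0 < c < 1 ->
  is_RInt (fun s => cos (m * landen c s) / sqrt (1 - c ^ 2 * sin s ^ 2)) 0 PI
    (kint (1 / 2) m c).
Proof.
intros Hc.
replace (kint (1 / 2) m c) with
  (RInt (fun t => cos (m * t) * Rpower (ker c t) (- (1 / 2)))
     (landen c 0) (landen c PI)).
2:{ unfold kint, landen.
  rewrite sin_0, sin_PI, Rmult_0_r, asin_0; f_equal; ring. }
eapply (is_RInt_ext (V := R_NormedModule)); [|
  apply (is_RInt_comp (V := R_CompleteNormedModule)
    (fun t => cos (m * t) * Rpower (ker c t) (- (1 / 2))) (landen c)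
    (fun s => 1 - c * cos s / sqrt (1 - c ^ 2 * sin s ^ 2)))].
- intros s _; simpl; rewrite Rpower_ker_landen by trivial.
  pose proof (landen_side_pos c s Hc).
  pose proof (sqrt_lt_R0 _ (elliptic_pos c s Hc)).
  unfold scal; simpl; unfold mult; simpl.
  replace (c * (c * 1)) with (c ^ 2) by ring.
  replace (sin s * (sin s * 1)) with (sin s ^ 2) by ring.
  field; lra.
- intros s _; now apply continuous_kint.
- intros s _; split; [now apply is_derive_landen|].
  apply (ex_derive_continuous (V := R_NormedModule)).
  pose proof (elliptic_pos c s Hc) as H.
  pose proof (sqrt_lt_R0 _ H).
  auto_derive; replace (1 + - (c * (c * 1) * (sin s * (sin s * 1))))
    with (1 - c ^ 2 * sin s ^ 2) by ring; lra.
Qed.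

Lemma kint_half_0 (c : R) : 0 < c < 1 -> kint (1 / 2) 0 c = 2 * ellK (c ^ 2).
Proof.
intros Hc; pose proof (is_RInt_landen 0 c Hc) as H.
apply (is_RInt_unique (V := R_CompleteNormedModule)) in H; rewrite <- H.
apply (is_RInt_unique (V := R_CompleteNormedModule)).
eapply (is_RInt_ext (V := R_NormedModule)); [|now apply is_RInt_ellK].
intros s _; simpl; rewrite Rmult_0_l, cos_0; unfold Rdiv; ring.
Qed.

(** By [cos_landen], [cos t / d = cos s + c sin^2 s / d]. Here [c^2 sin^2 s = 1 - d^2] turns the
    last term into [(1 / d - d) / c], and [cos s] integrates to 0. *)
Lemma kint_half_1 (c : R) : 0 < c < 1 ->
  kint (1 / 2) 1 c = 2 / c * (ellK (c ^ 2) - ellE (c ^ 2)).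
Proof.
intros Hc; pose proof (is_RInt_landen 1 c Hc) as H.
apply (is_RInt_unique (V := R_CompleteNormedModule)) in H; rewrite <- H.
apply (is_RInt_unique (V := R_CompleteNormedModule)).
replace (2 / c * (ellK (c ^ 2) - ellE (c ^ 2))) with
  (plus (minus (sin PI) (sin 0))
     (scal (/ c) (minus (2 * ellK (c ^ 2)) (2 * ellE (c ^ 2))))).
2:{ rewrite sin_PI, sin_0; unfold plus, minus, opp, scal; simpl.
  unfold mult, plus; simpl; field; lra. }
eapply (is_RInt_ext (V := R_NormedModule)); [|
  apply (is_RInt_plus (V := R_NormedModule));
  [ apply (is_RInt_derive (V := R_CompleteNormedModule) sin cos)
  | apply (is_RInt_scal (V := R_NormedModule)),
      (is_RInt_minus (V := R_NormedModule));
      [ apply is_RInt_ellK, Hc | apply is_RInt_ellE, Hc ] ] ].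
- intros s _.
  rewrite Rmult_1_l, cos_landen by trivial.
  pose proof (sqrt_lt_R0 _ (elliptic_pos c s Hc)).
  pose proof (sqrt_sqrt _ (Rlt_le _ _ (elliptic_pos c s Hc))) as H1.
  set (d := sqrt _) in *.
  change (cos s + / c * (/ d - d) = (cos s * d + c * sin s ^ 2) / d).
  apply (Rmult_eq_reg_r (c * d)); [|nra].
  transitivity (cos s * c * d + (1 - d * d)); [field; lra|].
  rewrite H1; field; lra.
- intros s _; auto_derive; trivial; ring.
- intros s _; apply continuous_cos.
Qed.

(** * Closed form of mu *)

Lemma sin_INR_PI (n : nat) : sin (INR n * PI) = 0.
Proof.
induction n as [|n IH]; [now rewrite Rmult_0_l, sin_0|].
rewrite S_INR; replace ((INR n + 1) * PI) with (INR n * PI + PI) by ring.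
now rewrite neg_sin, IH, Ropp_0.
Qed.

Lemma half_odd_S (q : nat) : half_odd (S q) = half_odd q + 1.
Proof. unfold half_odd; rewrite S_INR; ring. Qed.

Lemma half_odd_pos (q : nat) : 0 < half_odd q.
Proof. unfold half_odd; pose proof (pos_INR q); lra. Qed.

Lemma kint_three_halves_0 (c : R) : 0 < c < 1 ->
  (1 - c ^ 2) ^ 2 * kint (3 / 2) 0 c
  = 4 * ellE (c ^ 2) - 2 * (1 - c ^ 2) * ellK (c ^ 2).
Proof.
intros Hc; pose proof (kint_0_rec (1 / 2) c Hc) as H.
replace (1 / 2 + 1) with (3 / 2) in H by lra.
rewrite kint_half_0, kint_half_1 in H by trivial.
rewrite H by lra; field; lra.
Qed.

Lemma mu_init_kint (q : nat) (c : R) : 0 < c < 1 ->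
  mu_init q c = (1 - c) ^ (2 * q) * kint (half_odd q) 0 c.
Proof.
intros Hc.
assert (Hc2 : (1 - c ^ 2) ^ 2 <> 0) by (apply pow_nonzero; nra).
destruct q as [|[|[|q]]].
- replace (half_odd 0) with (1 / 2) by (unfold half_odd; simpl; lra).
  rewrite kint_half_0 by trivial; simpl; ring.
- replace (half_odd 1) with (3 / 2) by (unfold half_odd; simpl; lra).
  replace (kint (3 / 2) 0 c)
    with ((1 - c ^ 2) ^ 2 * kint (3 / 2) 0 c / (1 - c ^ 2) ^ 2)
    by (field; nra).
  rewrite kint_three_halves_0 by trivial.
  simpl (mu_init 1 c); simpl (2 * 1)%nat.
  replace (c * (c * 1)) with (c ^ 2) by ring.
  generalize (ellE (c ^ 2)) (ellK (c ^ 2)); intros E K.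
  (* The factor [(1 - c)^2] cancels the normalization of [mu], so that only powers of [1 + c] remain
     in the denominator. *)
  replace ((1 - c ^ 2) ^ 2) with ((1 - c) ^ 2 * (1 + c) ^ 2) by ring.
  field; lra.
- replace (half_odd 2) with (3 / 2 + 1) by (unfold half_odd; simpl; lra).
  replace (kint (3 / 2 + 1) 0 c)
    with ((1 - c ^ 2) ^ 2 * kint (3 / 2 + 1) 0 c / (1 - c ^ 2) ^ 2)
    by (field; nra).
  (* Level [5/2] needs the orders 0 and 1 at level [3/2]; order 1 is [kint_rec] at [p = 1/2],
     [m = 0], which leads back to order 0. *)
  rewrite kint_0_rec by lra.
  pose proof (kint_rec (1 / 2) 0 c Hc ltac:(lra)) as H.
  rewrite Rmult_0_l in H; specialize (H sin_0).
  replace (1 / 2 + 1) with (3 / 2) in H by lra.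
  rewrite Rplus_0_l in H; rewrite H, kint_half_0 by trivial; clear H.
  replace (kint (3 / 2) 0 c)
    with ((1 - c ^ 2) ^ 2 * kint (3 / 2) 0 c / (1 - c ^ 2) ^ 2)
    by (field; nra).
  rewrite kint_three_halves_0 by trivial.
  simpl (mu_init 2 c); simpl (2 * 2)%nat.
  replace (c * (c * 1)) with (c ^ 2) by ring.
  generalize (ellE (c ^ 2)) (ellK (c ^ 2)); intros E K.
  replace ((1 - c ^ 2) ^ 2) with ((1 - c) ^ 2 * (1 + c) ^ 2) by ring.
  field; lra.
(* Here [mu_init] is already the kernel integral, with exponent [2 p - 1 = 2 Q]. *)
- set (Q := S (S (S q))).
  change (mu_init Q c) with
    (Rpower (1 - c) (2 * half_odd Q - 1)
     * RInt (fun t => Rpower (ker c t) (- half_odd Q)) 0 PI).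
  f_equal.
  + rewrite <- Rpower_pow by lra; f_equal.
    unfold half_odd; rewrite mult_INR; simpl (INR 2); lra.
  + apply RInt_ext; intros t _; now rewrite Rmult_0_l, cos_0, Rmult_1_l.
Qed.

Lemma mu_half_kint (c : R) (m : nat) : 0 < c < 1 ->
  mu_half c m = kint (1 / 2) (INR m) c.
Proof.
intros Hc.
enough (H : mu_half c m = kint (1 / 2) (INR m) c /\
            mu_half c (S m) = kint (1 / 2) (INR (S m)) c) by apply H.
induction m as [|m [IH1 IH2]].
- simpl; replace (c * (c * 1)) with (c ^ 2) by ring.
  now rewrite kint_half_0, kint_half_1 by trivial.
- split; [exact IH2|].
  change (mu_half c (S (S m))) with
    ((1 + c ^ 2) / c * (2 * (INR (S (S m)) - 1) / (2 * INR (S (S m)) - 1))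
       * mu_half c (S m)
     - (2 * INR (S (S m)) - 3) / (2 * INR (S (S m)) - 1) * mu_half c m).
  rewrite IH1, IH2.
  pose proof (kint_half_rec (INR (S m)) c Hc (sin_INR_PI _)) as H.
  rewrite !S_INR in *; pose proof (pos_INR m).
  set (r := INR m) in *.
  replace (r + 1 - 1) with r in H by ring.
  apply (Rmult_eq_reg_l ((2 * (r + 1) + 1) * c)); [|nra].
  rewrite H; field; lra.
Qed.

(** The double induction follows the nested fixpoints. The coefficient [(1 - c)^2] in the recurrence
    for [mu] is the quotient of the normalizations at two successive levels, so what remains is
    [kint_rec]. *)
Lemma mu_nat_kint (q m : nat) (c : R) : 0 < c < 1 ->
  mu_nat q c m = (1 - c) ^ (2 * q) * kint (half_odd q) (INR m) c.
Proof.
intros Hc; revert m; induction q as [|q IHq]; intros m.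
- replace (half_odd 0) with (1 / 2) by (unfold half_odd; simpl; lra).
  simpl; rewrite mu_half_kint by trivial; ring.
- induction m as [|m IHm]; [now apply mu_init_kint|].
  change (mu_nat (S q) c (S m)) with
    ((1 + c ^ 2) / (2 * c) * mu_nat (S q) c m
     - (1 - c) ^ 2 / (2 * c)
       * ((half_odd (S q) + INR (S m) - 2) / (half_odd (S q) - 1))
       * mu_nat q c m).
  rewrite IHm, IHq, half_odd_S, S_INR.
  pose proof (half_odd_pos q).
  rewrite kint_rec by (try apply sin_INR_PI; lra).
  replace (2 * S q)%nat with (2 + 2 * q)%nat by lia; rewrite pow_add.
  field; lra.
Qed.

Lemma mu_kint (q : nat) (k : Z) (c : R) : 0 < c < 1 ->
  mu q k c = (1 - c) ^ (2 * q) * kint (half_odd q) (IZR k) c.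
Proof.
intros Hc; unfold mu; rewrite mu_nat_kint by trivial; f_equal.
rewrite INR_IZR_INZ, Zabs2Nat.id_abs, abs_IZR.
unfold Rabs; destruct (Rcase_abs (IZR k)); trivial; apply kint_opp.
Qed.

(** * Integrals over a period and continuity in a parameter *)

Lemma cos_sin_IZR_period (k : Z) (t : R) :
  cos (t + IZR k * (2 * PI)) = cos t /\ sin (t + IZR k * (2 * PI)) = sin t.
Proof.
assert (H : forall (n : nat) t,
  cos (t + INR n * (2 * PI)) = cos t /\ sin (t + INR n * (2 * PI)) = sin t).
{ intros n s; replace (s + INR n * (2 * PI)) with (s + 2 * INR n * PI) by ring.
  split; [apply cos_period|apply sin_period]. }
destruct (Z_le_dec 0 k) as [Hk|Hk].
- rewrite <- (Z2Nat.id k Hk), <- INR_IZR_INZ; apply H.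
- destruct (H (Z.to_nat (- k)) (t + IZR k * (2 * PI))) as [H1 H2].
  rewrite INR_IZR_INZ, Z2Nat.id, opp_IZR in H1, H2 by lia.
  replace (t + IZR k * (2 * PI) + - IZR k * (2 * PI)) with t in H1, H2 by ring.
  now split.
Qed.

Lemma is_RInt_of_continuous (g : R -> R) (u v : R) :
  (forall t, continuous g t) -> is_RInt g u v (RInt g u v).
Proof.
intros Hg; apply (RInt_correct (V := R_CompleteNormedModule)).
apply (ex_RInt_continuous (V := R_CompleteNormedModule)); intros; apply Hg.
Qed.

Lemma is_RInt_shift (g : R -> R) (d u v l : R) :
  is_RInt g (u + d) (v + d) l -> is_RInt (fun t => g (t + d)) u v l.
Proof.
intros H.
apply (is_RInt_ext (V := R_NormedModule)) with
  (fun t => scal 1 (g (1 * t + d))).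
- intros t _; unfold scal; simpl; unfold mult; simpl.
  now rewrite !Rmult_1_l.
- apply (is_RInt_comp_lin (V := R_NormedModule)); now rewrite !Rmult_1_l.
Qed.

(** Along the path [v], [u], [u + T], [v + T], the outer two pieces cancel by periodicity. *)
Lemma is_RInt_periodic (g : R -> R) (T u v l : R) :
  (forall t, continuous g t) -> (forall t, g (t + T) = g t) ->
  is_RInt g u (u + T) l -> is_RInt g v (v + T) l.
Proof.
intros Hc Hp Hu.
assert (H : is_RInt g (u + T) (v + T) (RInt g u v)).
{ replace u with (u + T + - T) at 2 by ring.
  replace v with (v + T + - T) at 2 by ring.
  apply (is_RInt_ext (V := R_NormedModule)) with (fun t => g (t + - T)).
  - intros t _; rewrite <- Hp; f_equal; ring.
  - apply is_RInt_shift, is_RInt_of_continuous, Hc. }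
replace l with (plus (opp (RInt g u v)) (plus l (RInt g u v)))
  by (unfold plus, opp; simpl; ring).
apply (is_RInt_Chasles (V := R_NormedModule)) with u.
- apply (is_RInt_swap (V := R_NormedModule)), is_RInt_of_continuous, Hc.
- now apply (is_RInt_Chasles (V := R_NormedModule)) with (u + T).
Qed.

Lemma is_RInt_symmetric (g : R -> R) (r l : R) : (forall t, continuous g t) ->
  is_RInt (fun t => g t + g (- t)) 0 r l -> is_RInt g (- r) r l.
Proof.
intros Hc Hl.
replace l with (plus (RInt g (- r) 0) (RInt g 0 r)).
{ apply (is_RInt_Chasles (V := R_NormedModule)) with 0;
    apply is_RInt_of_continuous, Hc. }
apply (is_RInt_unique (V := R_CompleteNormedModule)) in Hl; rewrite <- Hl.
symmetry; apply (is_RInt_unique (V := R_CompleteNormedModule)).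
apply (is_RInt_ext (V := R_NormedModule)) with
  (fun t => plus (opp (opp (g (- t)))) (g t)).
{ intros t _; unfold plus, opp; simpl; ring. }
apply (is_RInt_plus (V := R_NormedModule)); [|apply is_RInt_of_continuous, Hc].
rewrite <- (opp_opp (RInt g (- r) 0)).
apply (is_RInt_opp (V := R_NormedModule)).
apply (is_RInt_comp_opp (V := R_NormedModule)).
rewrite Ropp_0; apply (is_RInt_swap (V := R_NormedModule)).
apply is_RInt_of_continuous, Hc.
Qed.

(** This treats [cos (k t)] and [sin (k t)] together: [ker] is even and periodic, so only the even
    part of [h] about [alpha] counts, and for both functions it is a multiple of [cos (k t)]. *)
Lemma is_RInt_trig_kernel (h : R -> R) (c p alpha l : R) (k : Z) : 0 < c < 1 ->
  (forall t, continuous h t) -> (forall t, h (t + 2 * PI) = h t) ->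
  (forall t, h (t + alpha) + h (- t + alpha) = l * cos (IZR k * t)) ->
  is_RInt (fun t => h t * Rpower (ker c (t - alpha)) (- p)) 0 (2 * PI)
    (l * kint p (IZR k) c).
Proof.
intros Hc Hh Hp Hs.
set (g := fun t => h (t + alpha) * Rpower (ker c t) (- p)).
assert (Hg : forall t, continuous g t).
{ intros t; apply (continuous_mult (fun t => h (t + alpha))).
  - apply (continuous_comp (fun t => t + alpha) h); [|apply Hh].
    apply (ex_derive_continuous (V := R_NormedModule)); auto_derive; trivial.
  - apply (ex_derive_continuous (V := R_NormedModule)).
    now apply ex_derive_ker_Rpower. }
apply (is_RInt_ext (V := R_NormedModule)) with (fun t => g (t + - alpha)).
{ intros t _; unfold g; f_equal; f_equal; ring. }
apply is_RInt_shift.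
replace (2 * PI + - alpha) with (0 + - alpha + 2 * PI) by ring.
apply is_RInt_periodic with (- PI); [exact Hg| |].
{ intros t; unfold g, ker; rewrite cos_plus, cos_2PI, sin_2PI.
  f_equal; [|f_equal; ring].
  rewrite <- (Hp (t + alpha)); f_equal; ring. }
replace (- PI + 2 * PI) with PI by ring.
apply is_RInt_symmetric; [exact Hg|].
apply (is_RInt_ext (V := R_NormedModule)) with
  (fun t => scal l (cos (IZR k * t) * Rpower (ker c t) (- p))).
{ intros t _; unfold g.
  replace (ker c (- t)) with (ker c t) by (unfold ker; now rewrite cos_neg).
  rewrite <- Rmult_plus_distr_r, Hs; unfold scal; simpl; unfold mult; simpl.
  ring. }
apply (is_RInt_scal (V := R_NormedModule)); now apply is_RInt_kint.
Qed.

Lemma is_RInt_cos_kernel (c p alpha : R) (k : Z) : 0 < c < 1 ->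
  is_RInt (fun t => cos (IZR k * t) * Rpower (ker c (t - alpha)) (- p))
    0 (2 * PI) (2 * cos (IZR k * alpha) * kint p (IZR k) c).
Proof.
intros Hc; apply (is_RInt_trig_kernel (fun t => cos (IZR k * t))); trivial.
- intros t; apply (ex_derive_continuous (V := R_NormedModule)).
  auto_derive; trivial.
- intros t; replace (IZR k * (t + 2 * PI))
    with (IZR k * t + IZR k * (2 * PI)) by ring.
  apply cos_sin_IZR_period.
- intros t; rewrite !Rmult_plus_distr_l, !cos_plus.
  replace (IZR k * - t) with (- (IZR k * t)) by ring.
  rewrite cos_neg, sin_neg; ring.
Qed.

Lemma is_RInt_sin_kernel (c p alpha : R) (k : Z) : 0 < c < 1 ->
  is_RInt (fun t => sin (IZR k * t) * Rpower (ker c (t - alpha)) (- p))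
    0 (2 * PI) (2 * sin (IZR k * alpha) * kint p (IZR k) c).
Proof.
intros Hc; apply (is_RInt_trig_kernel (fun t => sin (IZR k * t))); trivial.
- intros t; apply (ex_derive_continuous (V := R_NormedModule)).
  auto_derive; trivial.
- intros t; replace (IZR k * (t + 2 * PI))
    with (IZR k * t + IZR k * (2 * PI)) by ring.
  apply cos_sin_IZR_period.
- intros t; rewrite !Rmult_plus_distr_l, !sin_plus.
  replace (IZR k * - t) with (- (IZR k * t)) by ring.
  rewrite cos_neg, sin_neg; ring.
Qed.

Lemma continuity_2d_pt_slice1 (g : R -> R -> R) (s t : R) :
  continuity_2d_pt g s t -> continuous (fun r => g r t) s.
Proof.
intros Hg; apply continuity_pt_filterlim; intros eps Heps.
destruct (Hg (mkposreal eps Heps)) as [d H].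
exists d; split; [apply cond_pos|]; intros r [_ Hr]; apply H; [exact Hr|].
rewrite Rminus_diag, Rabs_R0; apply cond_pos.
Qed.

Lemma continuity_2d_pt_slice2 (g : R -> R -> R) (s t : R) :
  continuity_2d_pt g s t -> continuous (g s) t.
Proof.
intros Hg; apply continuity_pt_filterlim; intros eps Heps.
destruct (Hg (mkposreal eps Heps)) as [d H].
exists d; split; [apply cond_pos|]; intros r [_ Hr]; apply H; [|exact Hr].
rewrite Rminus_diag, Rabs_R0; apply cond_pos.
Qed.

Lemma continuous_RInt_param (g : R -> R -> R) (u v s : R) : u <= v ->
  (forall s t, continuity_2d_pt g s t) ->
  continuous (fun s => RInt (g s) u v) s.
Proof.
intros Huv Hg.
assert (Hgs : forall s t, continuous (g s) t)
  by (intros; now apply continuity_2d_pt_slice2).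
apply continuity_pt_filterlim; intros eps Heps.
(* The summand 1 allows [u = v] and keeps [(v - u) * M] strictly below [eps]. *)
set (M := eps / (2 * (v - u + 1))).
assert (HM : 0 < M) by (apply Rdiv_lt_0_compat; lra).
destruct (uniform_continuity_2d_1d' g u v s (fun t _ => Hg s t)
            (mkposreal M HM)) as [d Hd].
exists d; split; [apply cond_pos|].
intros r [_ Hr]; simpl in *; unfold Rdist in *.
pose proof (is_RInt_of_continuous (g r) u v (Hgs r)) as Ir.
pose proof (is_RInt_of_continuous (g s) u v (Hgs s)) as Is.
pose proof (is_RInt_minus (V := R_NormedModule) _ _ _ _ _ _ Ir Is) as Id.
assert (E : RInt (g r) u v - RInt (g s) u v
            = RInt (fun t => minus (g r t) (g s t)) u v)
  by (symmetry; exact (is_RInt_unique (V := R_CompleteNormedModule) _ _ _ _ Id)).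
change (Rabs (RInt (g r) u v - RInt (g s) u v) < eps); rewrite E.
apply Rle_lt_trans with ((v - u) * M).
- apply abs_RInt_le_const; [exact Huv|eexists; exact Id|].
  intros t Ht; apply Rlt_le, (Hd t s t r); try exact Ht.
  + pose proof (cond_pos d); lra.
  + apply Rabs_def2 in Hr; lra.
  + rewrite Rminus_diag, Rabs_R0; apply cond_pos.
- unfold M; apply Rmult_lt_reg_r with (2 * (v - u + 1)); [lra|].
  replace ((v - u) * (eps / (2 * (v - u + 1))) * (2 * (v - u + 1)))
    with ((v - u) * eps) by (field; lra).
  nra.
Qed.

(** * Geometry of the squared distance *)

Definition dist2 (a b : R -> R) (x y z theta phi : R) : R :=
  (a theta * sin theta * cos phi - x) ^ 2
  + (a theta * sin theta * sin phi - y) ^ 2 + (b theta * cos theta - z) ^ 2.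

Lemma dist2_pos (a b : R -> R) (x y z theta phi : R) :
  (forall phi, 0 <= phi < 2 * PI -> gamma a b theta phi <> (x, y, z)) ->
  0 < dist2 a b x y z theta phi.
Proof.
intros Hne; pose proof PI_RGT_0.
(* The hypothesis covers one period of [phi] only, so the angle is first reduced to [[0, 2 PI)]. *)
set (k := Int_part (phi / (2 * PI))).
set (psi := phi - IZR k * (2 * PI)).
assert (Hpsi : 0 <= psi < 2 * PI).
{ destruct (base_Int_part (phi / (2 * PI))) as [H1 H2]; fold k in H1, H2.
  unfold psi; replace phi with (phi / (2 * PI) * (2 * PI)) by (field; lra).
  nra. }
destruct (cos_sin_IZR_period k psi) as [Hcos Hsin].
replace (psi + IZR k * (2 * PI)) with phi in Hcos, Hsin by (unfold psi; ring).
unfold dist2; rewrite Hcos, Hsin.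
apply Rnot_le_lt; intros Hle; apply (Hne psi Hpsi).
set (u := a theta * sin theta * cos psi) in *.
set (v := a theta * sin theta * sin psi) in *.
set (w := b theta * cos theta) in *.
pose proof (pow2_ge_0 (u - x)); pose proof (pow2_ge_0 (v - y)).
pose proof (pow2_ge_0 (w - z)).
unfold gamma; fold u v w; repeat f_equal;
  apply Rminus_diag_uniq, Rsqr_0_uniq; rewrite Rsqr_pow2; lra.
Qed.

Lemma dist3_gamma (a b : R -> R) (x y z theta phi : R) :
  dist3 (gamma a b theta phi) (x, y, z) = sqrt (dist2 a b x y z theta phi).
Proof. reflexivity. Qed.

Lemma Rpower_sqrt_double (r p : R) : 0 < r ->
  Rpower (sqrt r) (2 * p) = Rpower r p.
Proof.
intros Hr; rewrite <- Rpower_sqrt, Rpower_mult by trivial; f_equal; lra.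
Qed.

Lemma dist2_polar (a b : R -> R) (x y z theta phi : R) : 0 < rho x y ->
  dist2 a b x y z theta phi
  = a theta ^ 2 * sin theta ^ 2 + rho x y ^ 2 + (b theta * cos theta - z) ^ 2
    - 2 * a theta * (rho x y * sin theta) * cos (phi - atan2 y x).
Proof.
intros Hr; destruct (atan2_spec x y Hr) as [Hx [Hy _]].
set (r := rho x y) in *; set (al := atan2 y x) in *.
unfold dist2; rewrite cos_minus.
rewrite Hx, Hy.
pose proof (sin2_cos2 phi) as H1; pose proof (sin2_cos2 al) as H2.
unfold Rsqr in H1, H2.
(* Inserting [sin^2 + cos^2 = 1] into both squares makes the law of cosines a polynomial
   identity. *)
replace (r ^ 2) with (r ^ 2 * (sin al * sin al + cos al * cos al))
  by (rewrite H2; ring).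
replace (a theta ^ 2 * sin theta ^ 2)
  with (a theta ^ 2 * sin theta ^ 2 * (sin phi * sin phi + cos phi * cos phi))
  by (rewrite H1; ring).
ring.
Qed.

(** For every [u], [a L (1 - 2 c u + c^2)] equals [2 a (lambda - r u)], where [r = rho sin theta].
    The value [u = cos (phi - alpha)] gives the squared distance, and [u = 1] gives [R_lambda2]. *)
Lemma dist2_kernel (a b : R -> R) (x y z theta phi : R) :
  0 < rho x y -> 0 < a theta -> 0 < theta < PI ->
  (forall phi, 0 < dist2 a b x y z theta phi) ->
  let L := Lambda a b x y z theta in
  let c := chi a b x y z theta in
  0 < L /\ 0 < c < 1 /\
  R_lambda2 a b x y z theta = a theta * L * (1 - c) ^ 2 /\
  dist2 a b x y z theta phi = a theta * L * ker c (phi - atan2 y x).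
Proof.
intros Hr Ha Ht Hd L c.
assert (Hs : 0 < sin theta) by (apply sin_gt_0; lra).
(* [R_lambda2] is the squared distance at [phi = alpha]. Its positivity yields [r < lambda], hence a
   real square root and [c < 1]. *)
assert (HR : 0 < R_lambda2 a b x y z theta).
{ specialize (Hd (atan2 y x)); rewrite dist2_polar in Hd by trivial.
  rewrite Rminus_diag, cos_0 in Hd; unfold R_lambda2; nra. }
rewrite dist2_polar by trivial.
set (r := rho x y * sin theta) in *.
assert (Hrs : 0 < r) by now apply Rmult_lt_0_compat.
set (l := lambda a b x y z theta).
assert (Hl : 2 * a theta * l
  = a theta ^ 2 * sin theta ^ 2 + rho x y ^ 2 + (b theta * cos theta - z) ^ 2).
{ unfold l, lambda; field; lra. }
assert (HR2 : R_lambda2 a b x y z theta = 2 * a theta * l - 2 * a theta * r).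
{ rewrite Hl; unfold R_lambda2, r; ring. }
assert (Hlr : r < l) by nra.
assert (HL : L = l + sqrt (l ^ 2 - r ^ 2)).
{ unfold L, Lambda; fold l; unfold r; do 3 f_equal; ring. }
assert (Hq : 0 <= l ^ 2 - r ^ 2) by nra.
pose proof (sqrt_pos (l ^ 2 - r ^ 2)) as Hq0.
pose proof (sqrt_sqrt _ Hq) as Hq1.
assert (HL0 : r < L) by lra.
assert (HLL : L * L + r ^ 2 = 2 * l * L) by (rewrite HL; nra).
assert (Hc : c = r / L).
{ unfold c, chi, phi0, beta; simpl; fold L r.
  rewrite exp_Ropp, exp_ln by (apply Rdiv_lt_0_compat; lra).
  field; lra. }
assert (Hc1 : 0 < c < 1).
{ rewrite Hc; split; [apply Rdiv_lt_0_compat; lra|].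
  apply Rmult_lt_reg_r with L; [lra|].
  unfold Rdiv; rewrite Rmult_assoc, Rinv_l; lra. }
assert (Hk : forall u, a theta * L * (1 - 2 * c * u + c ^ 2)
                       = 2 * a theta * l - 2 * a theta * r * u).
{ intros u; rewrite Hc.
  replace (a theta * L * (1 - 2 * (r / L) * u + (r / L) ^ 2))
    with (a theta * ((L * L + r ^ 2) / L - 2 * r * u)) by (field; lra).
  rewrite HLL; field; lra. }
repeat split; try lra.
- rewrite HR2; replace ((1 - c) ^ 2) with (1 - 2 * c * 1 + c ^ 2) by ring.
  rewrite Hk; ring.
- unfold ker; rewrite Hk, <- Hl; ring.
Qed.

(* The three prefactors of the reduced integrand, together with the factor
   [(1 - chi)^(2 q)] of [mu], recombine to [(a Lambda)^-p]. *)
Lemma prefactor_combine (A L c : R) (q : nat) : 0 < A -> 0 < L -> 0 < c < 1 ->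
  1 / sqrt A * (1 / Rpower L (1 / 2))
    * (1 / Rpower (A * L * (1 - c) ^ 2) (half_odd q - 1 / 2))
    * (1 - c) ^ (2 * q)
  = Rpower (A * L) (- half_odd q).
Proof.
intros HA HL Hc.
assert (HAL : 0 < A * L) by now apply Rmult_lt_0_compat.
assert (H1c : 0 < (1 - c) ^ 2) by (apply pow_lt; lra).
replace (half_odd q - 1 / 2) with (INR q) by (unfold half_odd; ring).
rewrite Rpower_pow by now apply Rmult_lt_0_compat.
rewrite Rpow_mult_distr, <- pow_mult.
replace (- half_odd q) with (- (INR q + / 2)) by (unfold half_odd; lra).
rewrite Rpower_Ropp, Rpower_plus, Rpower_pow by trivial.
replace (1 / 2) with (/ 2) by lra.
rewrite !Rpower_sqrt, sqrt_mult by lra.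
pose proof (sqrt_lt_R0 _ HA); pose proof (sqrt_lt_R0 _ HL).
assert (0 < (A * L) ^ q) by now apply pow_lt.
assert (0 < (1 - c) ^ (2 * q)) by (apply pow_lt; lra).
field; lra.
Qed.

(** * Complex-valued functions *)

(* For [lo <= hi], the projection of the line onto [lo, hi]: composing with it
   makes functions that are smooth on [0, PI] continuous on the whole line. *)
Definition clamp (lo hi s : R) : R :=
  (Rabs (s - lo) - Rabs (s - hi) + lo + hi) / 2.

Lemma clamp_range (lo hi s : R) : lo <= hi -> lo <= clamp lo hi s <= hi.
Proof.
intros H; unfold clamp, Rabs.
destruct (Rcase_abs (s - lo)), (Rcase_abs (s - hi)); lra.
Qed.

Lemma clamp_id (lo hi s : R) : lo <= s <= hi -> clamp lo hi s = s.
Proof.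
intros H; unfold clamp; rewrite Rabs_pos_eq, Rabs_left1 by lra; field.
Qed.

Lemma continuous_clamp (lo hi s : R) : continuous (clamp lo hi) s.
Proof.
assert (H : forall u r, continuous (fun s => Rabs (s - u)) r).
{ intros u r; apply (continuous_comp (fun s => s - u) Rabs).
  - apply (ex_derive_continuous (V := R_NormedModule)); auto_derive; trivial.
  - apply continuous_Rabs. }
unfold clamp, Rdiv; apply (continuous_mult (K := R_AbsRing)).
- apply (continuous_plus (V := R_NormedModule));
    [|apply continuous_const].
  apply (continuous_plus (V := R_NormedModule)); [|apply continuous_const].
  apply (continuous_minus (V := R_NormedModule)); apply H.
- apply continuous_const.
Qed.

Lemma continuous_smooth_on_clamp (lo hi : R) (g : R -> R) (s : R) :
  lo <= hi -> smooth_on lo hi g -> continuous (fun s => g (clamp lo hi s)) s.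
Proof.
intros Hle [h [Hd Hh]].
apply (continuous_ext (fun s => h (clamp lo hi s))).
{ intros r; apply Hh, clamp_range, Hle. }
apply (continuous_comp (clamp lo hi) h); [apply continuous_clamp|].
apply (ex_derive_continuous (V := R_NormedModule)), (Hd 1%nat).
Qed.

Lemma continuous_smooth_strip_clamp (lo hi : R) (g : R -> R -> R) (s t : R) :
  lo <= hi -> smooth_strip lo hi g ->
  continuous (fun s => g (clamp lo hi s) t) s.
Proof.
intros Hle [h [Hd Hh]].
apply (continuous_ext (fun s => h (clamp lo hi s) t)).
{ intros r; apply Hh, clamp_range, Hle. }
apply (continuous_comp (clamp lo hi) (fun r => h r t));
  [apply continuous_clamp|].
exact (continuity_2d_pt_slice1 h _ _ (proj1 (Hd 0%nat (clamp lo hi s) t))).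
Qed.

Lemma continuity_2d_pt_comp1 (g : R -> R) (s t : R) :
  continuous g s -> continuity_2d_pt (fun u _ => g u) s t.
Proof.
intros Hg; apply (continuity_1d_2d_pt_comp g (fun u _ => u)).
- now apply continuity_pt_filterlim.
- apply continuity_2d_pt_id1.
Qed.

Lemma continuity_2d_pt_comp2 (g : R -> R) (s t : R) :
  continuous g t -> continuity_2d_pt (fun _ v => g v) s t.
Proof.
intros Hg; apply (continuity_1d_2d_pt_comp g (fun _ v => v)).
- now apply continuity_pt_filterlim.
- apply continuity_2d_pt_id2.
Qed.

Lemma continuity_2d_pt_sqr (g : R -> R -> R) (s t : R) :
  continuity_2d_pt g s t -> continuity_2d_pt (fun u v => g u v ^ 2) s t.
Proof.
intros Hg; apply continuity_2d_pt_ext with (fun u v => g u v * g u v).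
- intros; ring.
- now apply continuity_2d_pt_mult.
Qed.

Lemma continuity_2d_pt_dist2 (a b th : R -> R) (x y z s t : R) :
  (forall s, continuous (fun s => a (th s)) s) ->
  (forall s, continuous (fun s => b (th s)) s) ->
  (forall s, continuous th s) ->
  continuity_2d_pt (fun s t => dist2 a b x y z (th s) t) s t.
Proof.
intros Ha Hb Hth; unfold dist2.
assert (Hs : continuity_2d_pt (fun s _ => sin (th s)) s t).
{ apply (continuity_2d_pt_comp1 (fun s => sin (th s))).
  apply (continuous_comp th sin); [apply Hth|apply continuous_sin]. }
assert (Hc : continuity_2d_pt (fun s _ => cos (th s)) s t).
{ apply (continuity_2d_pt_comp1 (fun s => cos (th s))).
  apply (continuous_comp th cos); [apply Hth|apply continuous_cos]. }
repeat apply continuity_2d_pt_plus; apply continuity_2d_pt_sqr;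
  apply continuity_2d_pt_minus; try apply continuity_2d_pt_const;
  repeat apply continuity_2d_pt_mult; trivial.
- apply (continuity_2d_pt_comp1 (fun s => a (th s))), Ha.
- apply continuity_2d_pt_comp2, continuous_cos.
- apply (continuity_2d_pt_comp1 (fun s => a (th s))), Ha.
- apply continuity_2d_pt_comp2, continuous_sin.
- apply (continuity_2d_pt_comp1 (fun s => b (th s))), Hb.
Qed.

(** Continuity is taken by components because complex integrals are built here as pairs of real
    ones. *)
Definition Ccontinuous (g : R -> C) : Prop :=
  forall s, continuous (fun s => Re (g s)) s /\ continuous (fun s => Im (g s)) s.

Lemma Ccontinuous_mult (g h : R -> C) : Ccontinuous g -> Ccontinuous h ->
  Ccontinuous (fun s => Cmult (g s) (h s)).
Proof.
intros Hg Hh s; destruct (Hg s), (Hh s); split.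
- apply (continuous_minus (V := R_NormedModule));
    now apply (continuous_mult (K := R_AbsRing)).
- apply (continuous_plus (V := R_NormedModule));
    now apply (continuous_mult (K := R_AbsRing)).
Qed.

Lemma Ccontinuous_const (c : C) : Ccontinuous (fun _ => c).
Proof. intros s; split; apply continuous_const. Qed.

Lemma Ccontinuous_plus (g h : R -> C) : Ccontinuous g -> Ccontinuous h ->
  Ccontinuous (fun s => Cplus (g s) (h s)).
Proof.
intros Hg Hh s; destruct (Hg s), (Hh s).
split; now apply (continuous_plus (V := R_NormedModule)).
Qed.

Lemma Ccontinuous_ext (g h : R -> C) : (forall s, g s = h s) ->
  Ccontinuous g -> Ccontinuous h.
Proof.
intros E Hg s; destruct (Hg s) as [H1 H2].
split; [apply continuous_ext with (fun s => Re (g s))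
       |apply continuous_ext with (fun s => Im (g s))]; trivial;
  intros r; now rewrite E.
Qed.

Lemma Ccontinuous_sum_n_m (F : nat -> R -> C) (n m : nat) :
  (forall k, Ccontinuous (F k)) ->
  Ccontinuous (fun s => sum_n_m (G := C_AbelianMonoid) (fun k => F k s) n m).
Proof.
intros HF; induction m as [|m IH].
- destruct n as [|n].
  + apply Ccontinuous_ext with (F 0%nat); [|apply HF].
    intros s; now rewrite sum_n_n.
  + apply Ccontinuous_ext with (fun _ => zero); [|apply Ccontinuous_const].
    intros s; now rewrite sum_n_m_zero by lia.
- destruct (le_dec n (S m)) as [H|H].
  + eapply Ccontinuous_ext; [|exact (Ccontinuous_plus _ _ IH (HF (S m)))].
    intros s; now rewrite sum_n_Sm by lia.
  + apply Ccontinuous_ext with (fun _ => zero); [|apply Ccontinuous_const].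
    intros s; now rewrite sum_n_m_zero by lia.
Qed.

Lemma ex_CInt_Ccontinuous (g : R -> C) (u v : R) : Ccontinuous g -> ex_CInt g u v.
Proof.
intros Hg; exists (RInt (fun s => Re (g s)) u v, RInt (fun s => Im (g s)) u v).
apply (is_RInt_fct_extend_pair (U := R_NormedModule) (V := R_NormedModule));
  apply is_RInt_of_continuous; intros s; apply Hg.
Qed.

Lemma is_CInt_sum_n_m (F : nat -> R -> C) (l : nat -> C) (n m : nat) (u v : R) :
  (forall k, is_RInt (V := C_R_NormedModule) (F k) u v (l k)) ->
  is_RInt (V := C_R_NormedModule)
    (fun s => sum_n_m (G := C_AbelianMonoid) (fun k => F k s) n m) u v
    (sum_n_m (G := C_AbelianMonoid) l n m).
Proof.
intros HF.
(* This is the empty sum; the integral of a constant comes as [scal (v - u) zero] and is transported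
   to [zero]. *)
assert (H0 : is_RInt (V := C_R_NormedModule) (fun _ => zero) u v zero).
{ exact (eq_ind _ (is_RInt (V := C_R_NormedModule) (fun _ => zero) u v)
           (is_RInt_const (V := C_R_NormedModule) u v zero) _
           (scal_zero_r (V := C_R_NormedModule) (v - u))). }
induction m as [|m IH].
- destruct n as [|n].
  + rewrite sum_n_n.
    eapply is_RInt_ext; [|apply (HF 0%nat)].
    intros r _; now rewrite sum_n_n.
  + rewrite sum_n_m_zero by lia.
    eapply is_RInt_ext; [|exact H0].
    intros r _; now rewrite sum_n_m_zero by lia.
- destruct (le_dec n (S m)) as [H|H].
  + rewrite sum_n_Sm by lia.
    eapply is_RInt_ext;
      [|apply (is_RInt_plus (V := C_R_NormedModule)); [exact IH|apply (HF (S m))]].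
    intros r _; now rewrite sum_n_Sm by lia.
  + rewrite sum_n_m_zero by lia.
    eapply is_RInt_ext; [|exact H0].
    intros r _; now rewrite sum_n_m_zero by lia.
Qed.

Lemma sumZ_ext (lo hi : Z) (F G : Z -> C) : (forall k, F k = G k) ->
  sumZ lo hi F = sumZ lo hi G.
Proof. intros H; apply sum_n_m_ext; intros; apply H. Qed.

Lemma sumZ_mult_r (lo hi : Z) (F : Z -> C) (c : C) :
  sumZ lo hi (fun k => Cmult (F k) c) = Cmult (sumZ lo hi F) c.
Proof. apply (sum_n_m_mult_r (K := C_Ring)). Qed.

(** The weight [w] is real, so both components of each term are real combinations of its cosine and
    sine moments. *)
Lemma is_CInt_trig_sum (lo hi : Z) (A : Z -> C) (w : R -> R) (U V : Z -> R)
    (u v : R) :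
  (forall k, is_RInt (fun t => cos (IZR k * t) * w t) u v (U k)) ->
  (forall k, is_RInt (fun t => sin (IZR k * t) * w t) u v (V k)) ->
  is_RInt (V := C_R_NormedModule)
    (fun t => Cmult (sumZ lo hi (fun k => Cmult (A k) (cis (IZR k * t))))
                    (RtoC (w t))) u v
    (sumZ lo hi (fun k => Cmult (A k) (U k, V k))).
Proof.
intros HU HV.
eapply is_RInt_ext; [intros t _; apply sumZ_mult_r|].
apply is_CInt_sum_n_m; intros i; set (k := (lo - 1 + Z.of_nat i)%Z).
apply (is_RInt_fct_extend_pair (U := R_NormedModule) (V := R_NormedModule)); simpl.
- eapply is_RInt_ext; [|
    apply (is_RInt_minus (V := R_NormedModule));
    apply (is_RInt_scal (V := R_NormedModule));
    [apply (HU k)|apply (HV k)]].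
  intros t _; simpl; unfold minus, plus, opp, scal; simpl; unfold mult; simpl.
  change (Re (A k)) with (fst (A k)); ring.
- eapply is_RInt_ext; [|
    apply (is_RInt_plus (V := R_NormedModule));
    apply (is_RInt_scal (V := R_NormedModule));
    [apply (HV k)|apply (HU k)]].
  intros t _; simpl; unfold minus, plus, opp, scal; simpl; unfold mult; simpl.
  ring.
Qed.

(** * The inner integral *)

Lemma is_RInt_trig_dist2 (a b : R -> R) (q : nat) (x y z theta : R) (k : Z) :
  0 < rho x y -> 0 < a theta -> 0 < theta < PI ->
  (forall phi, 0 < dist2 a b x y z theta phi) ->
  let M := 2 * (1 / sqrt (a theta)
                * (1 / Rpower (Lambda a b x y z theta) (1 / 2))
                * (1 / Rpower (R_lambda2 a b x y z theta) (half_odd q - 1 / 2)))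
           * mu q k (chi a b x y z theta) in
  is_RInt (fun t => cos (IZR k * t)
                    * Rpower (dist2 a b x y z theta t) (- half_odd q))
    0 (2 * PI) (cos (IZR k * atan2 y x) * M) /\
  is_RInt (fun t => sin (IZR k * t)
                    * Rpower (dist2 a b x y z theta t) (- half_odd q))
    0 (2 * PI) (sin (IZR k * atan2 y x) * M).
Proof.
intros Hr Ha Ht Hd M.
(* The angle 0 is a dummy: the three facts kept do not involve [phi]. *)
destruct (dist2_kernel a b x y z theta 0 Hr Ha Ht Hd) as [HL [Hc [HR _]]].
set (L := Lambda a b x y z theta) in *; set (c := chi a b x y z theta) in *.
set (P := Rpower (a theta * L) (- half_odd q)).
assert (HM : M = 2 * P * kint (half_odd q) (IZR k) c).
{ unfold M; rewrite mu_kint, HR by trivial; unfold P.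
  rewrite <- (prefactor_combine _ _ _ q Ha HL Hc); ring. }
assert (Hw : forall t, Rpower (dist2 a b x y z theta t) (- half_odd q)
                       = P * Rpower (ker c (t - atan2 y x)) (- half_odd q)).
{ intros t.
  destruct (dist2_kernel a b x y z theta t Hr Ha Ht Hd) as [_ [_ [_ E]]].
  fold L c in E; rewrite E, <- Rpower_mult_distr; trivial.
  - now apply Rmult_lt_0_compat.
  - now apply ker_pos. }
assert (Hg : forall (g : R -> R) u,
  is_RInt (fun t => g t * Rpower (ker c (t - atan2 y x)) (- half_odd q))
    0 (2 * PI) (2 * u * kint (half_odd q) (IZR k) c) ->
  is_RInt (fun t => g t * Rpower (dist2 a b x y z theta t) (- half_odd q))
    0 (2 * PI) (u * M)).
{ intros g u H; apply (is_RInt_scal (V := R_NormedModule) _ _ _ P) in H.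
  replace (u * M) with (scal P (2 * u * kint (half_odd q) (IZR k) c))
    by (rewrite HM; unfold scal; simpl; unfold mult; simpl; ring).
  eapply is_RInt_ext; [|exact H]; intros t _; rewrite Hw.
  unfold scal; simpl; unfold mult; simpl; ring. }
split; apply Hg; [now apply is_RInt_cos_kernel|now apply is_RInt_sin_kernel].
Qed.

(** The prefactor moves inside the sum, so that the terms can be compared with the moments in
    [is_RInt_trig_dist2]. *)
Lemma reduced_integrand_sumZ (a b : R -> R) (q : nat) (x y z : R) (n : nat)
    (f : R -> R -> C) (theta : R) :
  let M k := 2 * (1 / sqrt (a theta)
                  * (1 / Rpower (Lambda a b x y z theta) (1 / 2))
                  * (1 / Rpower (R_lambda2 a b x y z theta)
                           (half_odd q - 1 / 2)))
             * mu q k (chi a b x y z theta) in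
  reduced_integrand a b q x y z n f theta
  = sumZ (- (Z.of_nat n / 2)) (Z.of_nat n / 2 - 1)
      (fun k => Cmult (fhat n f k theta)
                  (cos (IZR k * atan2 y x) * M k, sin (IZR k * atan2 y x) * M k)).
Proof.
intros M; unfold reduced_integrand, calF; fold M.
set (r := 1 / sqrt (a theta) * _ * _).
rewrite Cmult_assoc, Cmult_comm, <- sumZ_mult_r.
apply sumZ_ext; intros k; unfold phi0; simpl Re.
assert (E : (cos (IZR k * atan2 y x) * M k, sin (IZR k * atan2 y x) * M k)
            = Cmult (cis (IZR k * atan2 y x)) (RtoC (M k))).
{ unfold Cmult, cis; simpl; f_equal; ring. }
rewrite E; unfold M; fold r.
rewrite !RtoC_mult; ring.
Qed.

(** * The outer integral: continuity in [theta] and the final identity *)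

Theorem theorem4p3 :
  forall (a b : R -> R) (p : R) (q : nat) (x y z : R) (f : R -> R -> C)
         (nphi : nat),
    smooth_on 0 PI a ->
    smooth_on 0 PI b ->
    (forall theta : R, 0 <= theta <= PI -> 0 < a theta) ->
    (forall theta : R, 0 <= theta <= PI -> 0 < b theta) ->
    0 < p ->
    2 * p = INR (2 * q + 1) ->
    (forall theta phi : R, 0 <= theta <= PI -> 0 <= phi < 2 * PI ->
       gamma a b theta phi <> (x, y, z)) ->
    0 < rho x y ->
    Csmooth_strip 0 PI f ->
    (forall theta phi : R, 0 <= theta <= PI ->
       f theta (phi + 2 * PI) = f theta phi) ->
    (0 < nphi)%nat ->
    Nat.Even nphi ->
    ex_layer_potential a b p (x, y, z) (f_trunc nphi f) /\
    ex_CInt (reduced_integrand a b q x y z nphi f) 0 PI /\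
    layer_potential a b p (x, y, z) (f_trunc nphi f)
    = CInt (reduced_integrand a b q x y z nphi f) 0 PI.
Proof.
intros a b p q x y z f n Sa Sb Ha _ _ Hp Hne Hr [SRe SIm] _ _ _.
pose proof PI_RGT_0 as HPI.
assert (Ep : p = half_odd q).
{ unfold half_odd; rewrite plus_INR, mult_INR in Hp; simpl in Hp; lra. }
assert (Hd : forall theta phi, 0 <= theta <= PI ->
               0 < dist2 a b x y z theta phi).
{ intros theta phi Ht; apply dist2_pos; intros; now apply Hne. }
set (cl := clamp 0 PI).
assert (Hcl : forall s, 0 <= cl s <= PI) by (intros; apply clamp_range; lra).
(* Clamping [theta] gives a weight that is defined and continuous on the whole plane. *)
set (W := fun s t => Rpower (dist2 a b x y z (cl s) t) (- p)).
assert (HW : forall s t, continuity_2d_pt W s t).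
{ intros s t; unfold W.
  refine (continuity_1d_2d_pt_comp (fun r => Rpower r (- p))
            (fun s t => dist2 a b x y z (cl s) t) s t _ _).
  - apply continuity_pt_filterlim.
    apply (ex_derive_continuous (V := R_NormedModule)
             (fun r => Rpower r (- p))).
    pose proof (Hd (cl s) t (Hcl s)); unfold Rpower; auto_derive; lra.
  - apply continuity_2d_pt_dist2; intros r.
    + apply continuous_smooth_on_clamp; [lra|exact Sa].
    + apply continuous_smooth_on_clamp; [lra|exact Sb].
    + apply continuous_clamp. }
assert (HWk : forall (g : R -> R) (k : Z) s t, (forall r, continuous g r) ->
  continuity_2d_pt (fun s t => g (IZR k * t) * W s t) s t).
{ intros g k s t Hg; apply continuity_2d_pt_mult; [|apply HW].
  apply (continuity_2d_pt_comp2 (fun t => g (IZR k * t))).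
  apply (continuous_comp (fun t => IZR k * t) g); [|apply Hg].
  apply (ex_derive_continuous (V := R_NormedModule)); auto_derive; trivial. }
set (U := fun k s => RInt (fun t => cos (IZR k * t) * W s t) 0 (2 * PI)).
set (V := fun k s => RInt (fun t => sin (IZR k * t) * W s t) 0 (2 * PI)).
assert (HU : forall k s,
  is_RInt (fun t => cos (IZR k * t) * W s t) 0 (2 * PI) (U k s)).
{ intros k s; apply is_RInt_of_continuous.
  intros t; apply (continuity_2d_pt_slice2 (fun s t => cos (IZR k * t) * W s t)).
  apply (HWk cos), continuous_cos. }
assert (HV : forall k s,
  is_RInt (fun t => sin (IZR k * t) * W s t) 0 (2 * PI) (V k s)).
{ intros k s; apply is_RInt_of_continuous.
  intros t; apply (continuity_2d_pt_slice2 (fun s t => sin (IZR k * t) * W s t)).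
  apply (HWk sin), continuous_sin. }
(* [G] is the inner integral written with moments instead of [mu], hence meaningful and continuous
   at the poles as well. *)
set (G := fun s => sumZ (- (Z.of_nat n / 2)) (Z.of_nat n / 2 - 1)
  (fun k => Cmult (fhat n f k (cl s)) (U k s, V k s))).
assert (HG : Ccontinuous G).
{ apply Ccontinuous_sum_n_m; intros i.
  set (k := (- (Z.of_nat n / 2) - 1 + Z.of_nat i)%Z).
  apply Ccontinuous_mult.
  - apply Ccontinuous_mult; [apply Ccontinuous_const|].
    apply Ccontinuous_sum_n_m; intros j.
    apply Ccontinuous_mult; [|apply Ccontinuous_const].
    intros s; split.
    + apply (continuous_smooth_strip_clamp 0 PI (fun s t => Re (f s t)));
        [lra|exact SRe].
    + apply (continuous_smooth_strip_clamp 0 PI (fun s t => Im (f s t)));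
        [lra|exact SIm].
  - intros s; split.
    + apply (continuous_RInt_param (fun s t => cos (IZR k * t) * W s t)); [lra|].
      intros r t; apply (HWk cos), continuous_cos.
    + apply (continuous_RInt_param (fun s t => sin (IZR k * t) * W s t)); [lra|].
      intros r t; apply (HWk sin), continuous_sin. }
assert (Hin : forall theta, 0 <= theta <= PI ->
  is_RInt (V := C_R_NormedModule)
    (kernel_integrand a b p (x, y, z) (f_trunc n f) theta) 0 (2 * PI) (G theta)).
{ intros theta Ht.
  eapply is_RInt_ext; [|
    apply (is_CInt_trig_sum _ _ _ (W theta) (fun k => U k theta)
             (fun k => V k theta)); intros k; [apply HU|apply HV]].
  intros t _; unfold kernel_integrand, f_trunc, Cdiv, W, cl.
  rewrite clamp_id by exact Ht.
  rewrite dist3_gamma, Rpower_sqrt_double, Rpower_Ropp by now apply Hd.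
  rewrite RtoC_inv; [reflexivity|].
  apply Rgt_not_eq, exp_pos. }
assert (Hinner : forall theta, 0 <= theta <= PI ->
  inner_potential a b p (x, y, z) (f_trunc n f) theta = G theta).
{ intros theta Ht.
  apply (is_RInt_unique (V := C_R_CompleteNormedModule)), Hin, Ht. }
(* Agreement on the open interval suffices, since the Riemann integral ignores the values at its
   endpoints. *)
assert (Hred : forall theta, Rmin 0 PI < theta < Rmax 0 PI ->
  G theta = reduced_integrand a b q x y z n f theta).
{ rewrite Rmin_left, Rmax_right by lra.
  intros theta Ht; rewrite reduced_integrand_sumZ.
  unfold G; apply sumZ_ext; intros k.
  assert (Htc : cl theta = theta) by (apply clamp_id; lra).
  destruct (is_RInt_trig_dist2 a b q x y z theta k Hr (Ha theta ltac:(lra)) Ht)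
    as [H1 H2]; [intros; apply Hd; lra|].
  unfold U, V, W; rewrite Htc, Ep.
  apply (is_RInt_unique (V := R_CompleteNormedModule)) in H1, H2.
  now rewrite H1, H2. }
assert (HGint : ex_CInt G 0 PI) by now apply ex_CInt_Ccontinuous.
assert (Hpot : forall theta, Rmin 0 PI < theta < Rmax 0 PI ->
  G theta = inner_potential a b p (x, y, z) (f_trunc n f) theta).
{ rewrite Rmin_left, Rmax_right by lra.
  intros theta Ht; symmetry; apply Hinner; lra. }
split; [split|split].
- intros theta Ht; exists (G theta); now apply Hin.
- exact (ex_RInt_ext (V := C_R_NormedModule) _ _ _ _ Hpot HGint).
- exact (ex_RInt_ext (V := C_R_NormedModule) _ _ _ _ Hred HGint).
- apply (RInt_ext (V := C_R_CompleteNormedModule)); intros theta Ht.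
  now rewrite <- Hpot, Hred.
Qed.
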